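(* Let $n \ge 2$ and let $X$ with $|X| = k \le 2n$ be a non-empty finite subset of $\mathbb{R}^n$, where $\mathbb{R}^n$ has the metric induced by the $1$-norm $\|\cdot\|_1$. Then \[ M(X) \le \min\left(\frac{k}{4},\, \frac{n}{2} - \frac{1}{4}\right)\cdot D(X). \]
   Context: For a compact (in particular finite) metric space $(X,d)$, $D(X)$ denotes its metric diameter, and $M(X) = \sup_\mu \int_X\int_X d(x,y)\,d\mu(x)\,d\mu(y)$, where $\mu$ ranges over all finite signed Borel measures on $X$ of total mass $1$. *)

(* Defs.v *)
From HB Require Import structures.
From mathcomp Require Import all_boot all_order all_algebra.
From mathcomp Require Import all_classical all_reals all_analysis.

Set Implicit Arguments.
Unset Strict Implicit.
Unset Printing Implicit Defensive.

Import Order.TTheory GRing.Theory Num.Theory.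
Import numFieldNormedType.Exports.

Local Open Scope classical_set_scope.
Local Open Scope ring_scope.

(* 'rV[R]_n already carries the sup-norm metric, hence an alias. *)
Definition l1space (R : realType) (n : nat) : Type := 'rV[R]_n.

HB.instance Definition _ (R : realType) (n : nat) :=
  Choice.copy (l1space R n) 'rV[R]_n.

Definition l1norm (R : realType) (n : nat) (x : 'rV[R]_n) : R :=
  \sum_(i < n) `|x 0 i|.

Definition l1dist (R : realType) (n : nat) (x y : l1space R n) : R :=
  l1norm ((x : 'rV[R]_n) - y).

Section l1_metric.
Variables (R : realType) (n : nat).
Implicit Types x y z : l1space R n.

Lemma l1distxx x : l1dist x x = 0.
Proof.
by rewrite /l1dist /l1norm big1// => i _; rewrite subrr mxE normr0.
Qed.

Lemma l1dist_positivity x y : l1dist x y = 0 -> x = y.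
Proof.
move=> /eqP; rewrite psumr_eq0// => /allP xy0.
apply/rowP => i; have := xy0 i (mem_index_enum i).
by rewrite /= !mxE normr_eq0 subr_eq0 => /eqP.
Qed.

Lemma l1dist_sym x y : l1dist x y = l1dist y x.
Proof. by apply: eq_bigr => i _; rewrite !mxE distrC. Qed.

Lemma l1dist_triangle y x z : l1dist x z <= l1dist x y + l1dist y z.
Proof.
rewrite /l1dist /l1norm -big_split/=.
by apply: ler_sum => i _; rewrite !mxE; exact: ler_distD.
Qed.

HB.instance Definition _ := isMetric.Build R (l1space R n)
  l1distxx l1dist_positivity l1dist_sym l1dist_triangle.

End l1_metric.

(* Measurable types are pointed, so the Borel structure of a metric space needs
   a point. *)
#[short(type="pointedMetricType")]
HB.structure Definition PointedMetric (K : numDomainType) :=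
  {T of Pointed T & Metric K T}.

(* A nonempty subset A of a metric space, with the induced metric; the point is
   an arbitrary element of A. *)
Definition subspaceType (R : realType) (T : metricType R) (A : set T)
  (A0 : A !=set0) : Type := set_type A.

Section subspace_metric.
Variables (R : realType) (T : metricType R) (A : set T) (A0 : A !=set0).

HB.instance Definition _ := Choice.copy (subspaceType A0) (set_type A).

Let dist (x y : subspaceType A0) : R := mdist (set_val x) (set_val y).

Let distxx x : dist x x = 0.
Proof. exact: mdistxx. Qed.

Let dist_positivity x y : dist x y = 0 -> x = y.
Proof. by move/mdist_positivity; exact: val_inj. Qed.

Let dist_sym x y : dist x y = dist y x.
Proof. exact: metric_sym. Qed.

Let dist_triangle y x z : dist x z <= dist x y + dist y z.
Proof. exact: metric_triangle. Qed.

HB.instance Definition _ := isMetric.Build R (subspaceType A0)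
  distxx dist_positivity dist_sym dist_triangle.

HB.instance Definition _ := isPointed.Build (subspaceType A0)
  (let: exist x Ax := cid A0 in exist _ x (mem_set Ax)).

End subspace_metric.

Local Open Scope ereal_scope.

Section charge_integral.
Context (d : measure_display) (T : measurableType d) (R : realType).
Variable nu : {charge set T -> \bar R}.

Definition hahn_pos : set T := sval (cid (Hahn_decomposition nu)).

Definition hahn_neg : set T := sval (cid (svalP (cid (Hahn_decomposition nu)))).

Lemma hahn_pos_neg : hahn_decomposition nu hahn_pos hahn_neg.
Proof. exact: (svalP (cid (svalP (cid (Hahn_decomposition nu))))). Qed.

(* Integral against a signed measure, through its Jordan decomposition; the
   latter is independent of the chosen Hahn decomposition
   (Hahn_decomposition_uniq). *)
Definition charge_integral (f : T -> \bar R) : \bar R :=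
  \int[jordan_pos hahn_pos_neg]_x f x - \int[jordan_neg hahn_pos_neg]_x f x.

End charge_integral.

Section diameter_and_M.
Variables (R : realType) (T : pointedMetricType R).

Definition borelType := g_sigma_algebraType (@open T).

Definition diameter : \bar R :=
  ereal_sup [set (mdist p.1 p.2)%:E | p in [set: T * T]].

(* A charge takes only finite values on measurable sets. *)
Definition energy (mu : {charge set borelType -> \bar R}) : \bar R :=
  charge_integral mu (fun x =>
    charge_integral mu (fun y => (mdist (x : T) (y : T))%:E)).

Definition M_const : \bar R :=
  ereal_sup [set energy mu | mu in
    [set mu : {charge set borelType -> \bar R} | mu [set: borelType] = 1]].

End diameter_and_M.

(* Main.v *)
(* The [1]-norm metric on a finite set of [k] points is a nonnegative combination
   [d(x, y) = \sum_A lam A * [A separates x and y]] of cut metrics, so a signed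
   measure [w] of mass [1] has energy [\sum_A lam A * 2 w(A) (1 - w(A))].

   Let [M] be the total weight of the nontrivial cuts.  Since [2 t (1 - t) <= 1/2],
   the energy is at most [M / 2].  Summing [d] over all pairs gives
   [M <= (k / 2) D], because a nontrivial cut separates at least [k - 1] pairs; this
   yields the bound [(k / 4) D].

   For [k >= 4] the constant improves to [(k - 1) / 4].  Let [L p] be the weight of
   the cuts isolating [p], and let [p] minimize it.  The same counting without [p]
   gives [M - L p <= ((k - 1) / 2) D], while the isolating cuts lower the energy by
   [2 \sum_q L q (w q - 1/2)^2 >= 2 (L p) (k - 2)^2 / (4 k) >= L p / 2].  The two
   bounds together imply the claim: [k <= 2 n] gives [(k - 1) / 4 <= n / 2 - 1/4],
   and if [k <= 3] then [k / 4 <= n / 2 - 1/4] because [n >= 2]. *)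

Require Import Defs.
From mathcomp Require Import all_boot all_order all_algebra.
From mathcomp Require Import all_classical all_reals all_analysis.
From mathcomp Require Import ring lra zify.

Set Implicit Arguments.
Unset Strict Implicit.
Unset Printing Implicit Defensive.

Import Order.TTheory GRing.Theory Num.Theory.

Local Open Scope ring_scope.

(** * Cut metrics on a finite type and bounds on their energies *)

Section cut_metrics.
Variables (R : realFieldType) (T : finType).
Implicit Types (x y p : T) (S A : {set T}) (lam : {set T} -> R) (f w : T -> R).

Definition cutdist lam x y : R :=
  \sum_A lam A * ((x \in A) != (y \in A))%:R.

Lemma cutdist_sum (I : finType) (lam : I -> {set T} -> R) x y :
  cutdist (fun A => \sum_i lam i A) x y = \sum_i cutdist (lam i) x y.
Proof.
rewrite /cutdist exchange_big/=; apply: eq_bigr => A _.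
by rewrite mulr_suml.
Qed.

Lemma cutdistxx lam x : cutdist lam x x = 0.
Proof. by rewrite /cutdist big1// => A _; rewrite eqxx mulr0. Qed.

(* Lowering the points where [f] attains its maximum to the second largest value
   splits off one cut. *)
Lemma line_cutdist f : exists lam, (forall A, 0 <= lam A) /\
  forall x y, `|f x - f y| = cutdist lam x y.
Proof.
(* Induction on the number of points strictly below an upper bound [m], which need not be
   attained. *)
suff H N g m : (forall x, g x <= m) -> (#|[pred x | (g x < m)%R]| < N)%N ->
    exists lam, (forall A, 0 <= lam A) /\
      forall x y, `|g x - g y| = cutdist lam x y.
  apply: (H #|T|.+1 f (\sum_x `|f x|)); last by rewrite ltnS max_card.
  move=> x; rewrite (bigD1 x)//= (le_trans (ler_norm _))// lerDl.
  by apply: sumr_ge0.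
elim: N g m => [//|N IHN] g m gm; rewrite ltnS => gN.
have [x0 x0m|gm_eq] := pickP [pred x | (g x < m)%R]; last first.
  exists (fun=> 0); split=> // x y.
  have gE z : g z = m by apply/le_anti; rewrite gm leNgt; have /= -> := gm_eq z.
  rewrite !gE subrr normr0 /cutdist big1// => A _.
  by rewrite mul0r.
have [x1 /= x1m x1max] := @arg_maxP _ _ _ x0 [pred x | (g x < m)%R] g x0m.
pose h x := Num.min (g x) (g x1).
have gE x : if (g x < m)%R then h x = g x else h x = g x1 /\ g x = m.
  case: ifPn => [/x1max xx1|]; first by rewrite /h min_l.
  rewrite -leNgt => mx; have gxm : g x = m by apply/le_anti; rewrite gm.
  by rewrite /h min_r ?gxm// ltW.
have [||lam [lam0 lamE]] := IHN h (g x1).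
- by move=> x; rewrite /h ge_min lexx orbT.
- apply: leq_trans gN; apply: proper_card; apply/properP; split.
    apply/fintype.subsetP => x; rewrite !inE /h gt_min ltxx orbF => xx1.
    exact: lt_trans x1m.
  by exists x1; rewrite !inE// /h minxx ltxx.
pose B := [set x | ~~ (g x < m)%R]%SET.
exists (fun A => lam A + (A == B)%:R * (m - g x1)); split=> [A|x y].
  by rewrite addr_ge0// mulr_ge0// subr_ge0 ltW.
transitivity (cutdist lam x y + (m - g x1) * ((x \in B) != (y \in B))%:R).
  rewrite -lamE /B !inE; move: (gE x) (gE y).
  have := ltW x1m; rewrite -subr_ge0 => mx1.
  case: ifPn => xm; case: ifPn => ym /=; rewrite ?mulr0 ?mulr1 ?addr0.
  - by move=> -> ->.
  - move=> -> [-> ->]; have := x1max x xm => /= xx1.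
    rewrite distrC (distrC _ (g x1)) !ger0_norm ?subr_ge0 ?(ltW xm)//.
    by ring.
  - move=> [-> ->] ->; have := x1max y ym => /= yx1.
    rewrite !ger0_norm ?subr_ge0 ?(ltW ym)//.
    by ring.
  - by move=> [-> ->] [-> ->]; rewrite !subrr.
rewrite /cutdist; under [RHS]eq_bigr do rewrite mulrDl.
rewrite big_split/=; congr (_ + _).
rewrite (bigD1 B)//= eqxx mul1r big1 ?addr0// => A /negPf ->.
by rewrite !mul0r.
Qed.

(** For one cut, separated pairs have one point on each side, so the double sum is twice the product
    of the masses of the two sides. *)
Lemma sum_cutdist lam w :
  \sum_x \sum_y w x * w y * cutdist lam x y =
  \sum_A lam A * (2 * (\sum_(x in A) w x) * (\sum_(x | x \notin A) w x)).
Proof.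
under eq_bigr do under eq_bigr do rewrite /cutdist mulr_sumr.
under eq_bigr do rewrite exchange_big.
rewrite exchange_big/=; apply: eq_bigr => A _.
rewrite (big_mkcond (mem A)) (big_mkcond (fun x => x \notin A))/=.
set a := fun x : T => if x \in A then w x else 0.
set b := fun x : T => if x \notin A then w x else 0.
transitivity (\sum_x \sum_y lam A * (a x * b y + b x * a y)).
  apply: eq_bigr => x _; apply: eq_bigr => y _; rewrite /a /b.
  by case: (x \in A); case: (y \in A) => /=; ring.
transitivity (\sum_x lam A * (a x * \sum_y b y + b x * \sum_y a y)).
  apply: eq_bigr => x _.
  by rewrite -mulr_sumr big_split/= -!mulr_sumr.
by rewrite -mulr_sumr big_split/= -!mulr_suml; ring.
Qed.

Definition splits S A := (0 < #|S :&: A|)%N && (0 < #|S :\: A|)%N.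

(* Double counting of the distances inside [S]: a cut splitting [S] into [a] and
   [b] points contributes to [a * b >= a + b - 1] pairs. *)
Lemma sum_splits_le lam (D : R) S : (forall A, 0 <= lam A) ->
  (forall x y, cutdist lam x y <= D) ->
  \sum_(A | splits S A) lam A <= #|S|%:R / 2 * D.
Proof.
move=> lam0 lamD.
have [S1|S1] := leqP #|S| 1%N.
  rewrite big1 => [|A]; last by rewrite /splits; have := cardsID A S; lia.
  have [/eqP|] := posnP #|S|.
    by move=> /eqP ->; rewrite !mul0r.
  move=> /card_gt0P[x _].
  (* [D] is nonnegative because it bounds the distance from [x] to itself. *)
  by rewrite mulr_ge0 ?divr_ge0// -(cutdistxx lam x).
pose w x : R := (x \in S)%:R.
have sumw (P : pred T) : \sum_(x | P x) w x = #|[pred x in S | P x]|%:R.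
  rewrite -sum1_card natr_sum big_mkcondr/= [RHS]big_mkcond/=.
  rewrite big_mkcond; apply: eq_bigr => x _; rewrite /w.
  by case: (P x); case: (x \in S).
have le1 : \sum_x \sum_y w x * w y * cutdist lam x y <=
    #|S|%:R * (#|S|%:R - 1) * D.
  (* The subtracted term removes the diagonal, where the distance vanishes; [w] is an indicator, so
     [w x * w x = w x]. *)
  apply: (@le_trans _ _ (\sum_x \sum_y (w x * w y - (x == y)%:R * w x) * D)).
    apply: ler_sum => x _; apply: ler_sum => y _.
    have [->|xy] := eqVneq x y.
      by rewrite cutdistxx mulr0 mul1r /w; case: (y \in S);
        rewrite ?mulr1 ?mulr0 subrr mul0r.
    by rewrite mul0r subr0 ler_wpM2l// /w -natrM.
  under eq_bigr => x _.
    rewrite -mulr_suml big_split/= -mulr_sumr sumw sumrN.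
    rewrite (bigD1 x)//= eqxx mul1r big1 ?addr0; last first.
      by move=> y /negPf; rewrite eq_sym => ->; rewrite mul0r.
    over.
  rewrite -mulr_suml big_split/= -mulr_suml sumrN sumw.
  rewrite (eq_card (_ : _ =i S)); last by move=> x; rewrite !inE andbT.
  by rewrite le_eqVlt; apply/orP; left; apply/eqP; ring.
have le2 : (\sum_(A | splits S A) lam A) * (2 * (#|S|%:R - 1)) <=
    \sum_x \sum_y w x * w y * cutdist lam x y.
  rewrite sum_cutdist mulr_suml big_mkcond/=; apply: ler_sum => A _.
  rewrite !sumw.
  have -> : #|[pred x in S | x \in A]| = #|S :&: A|.
    by apply: eq_card => x; rewrite !inE.
  have -> : #|[pred x in S | x \notin A]| = #|S :\: A|.
    by apply: eq_card => x; rewrite !inE andbC.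
  have := cardsID A S; rewrite /splits.
  set a := #|S :&: A|; set b := #|S :\: A| => abS.
  case: ifPn => [/andP[a0 b0]|_]; last by rewrite !mulr_ge0.
  rewrite ler_wpM2l// -mulrA ler_wpM2l// lerBlDr -abS -natrM -[1]/(1%:R).
  by rewrite -natrD ler_nat; nia.
have S0 : 0 < #|S|%:R - 1 :> R by rewrite subr_gt0 ltr1n.
have := le_trans le2 le1.
rewrite (_ : _ * (2 * _) = (2 * \sum_(A | splits S A) lam A) * (#|S|%:R - 1));
  last by ring.
rewrite (_ : _ * D = (#|S|%:R * D) * (#|S|%:R - 1)); last by ring.
by rewrite ler_pM2r// => h; lra.
Qed.

(** A cut is encoded by either of its sides, so the cut isolating [p] occurs as two sets. *)
Definition isolates p A := (A == [set p]%SET) || (A == ~: [set p]%SET).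

(** If removing [p] emptied one side of a nontrivial cut, that side would be exactly [p]. *)
Lemma splits_isolates p A : splits [set: T]%SET A -> ~~ isolates p A ->
  splits (~: [set p]%SET) A.
Proof.
move=> /andP[/card_gt0P[x xA] /card_gt0P[y yA]].
rewrite negb_or => /andP[Ap Anp]; apply/andP; split.
  apply/card_gt0P; move: xA; rewrite !inE/= => xA.
  have [z zA zp] : exists2 z, z \in A & z != p.
    apply/exists_inP; apply: contraR Ap => /exists_inPn Az.
    have Ap' z : z \in A -> z = p by move=> /Az; rewrite negbK => /eqP.
    apply/eqP/setP => z; rewrite inE; apply/idP/eqP => [/Ap'//|->].
    by rewrite -(Ap' x).
  by exists z; rewrite !inE zp.
apply/card_gt0P; move: yA; rewrite !inE/= andbT => yA.
have [z zA zp] : exists2 z, z \notin A & z != p.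
  apply/exists_inP; apply: contraR Anp => /exists_inPn Az.
  have Ap' z : z \notin A -> z = p by move=> /Az; rewrite negbK => /eqP.
  apply/eqP/setP => z; rewrite !inE; apply/idP/idP => [zA|zp].
    by apply: contraTneq zA => ->; rewrite -(Ap' y yA).
  by apply: contraR zp => /Ap' ->.
by exists z; rewrite !inE zp zA.
Qed.

Lemma isolates_splits p A : (1 < #|T|)%N -> isolates p A ->
  splits [set: T]%SET A.
Proof.
move=> T1 Ap; rewrite /splits.
have := cardsID A [set: T]%SET; rewrite cardsT finset.setTI.
by case/orP: Ap => /eqP ->; rewrite ?cardsC1 ?cards1; lia.
Qed.

(** From three points on, a singleton and the complement of a singleton differ in size. *)
Lemma isolates_inj p q A : (2 < #|T|)%N -> isolates p A -> isolates q A ->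
  p = q.
Proof.
move=> T2 /orP[]/eqP-> /orP[] /eqP.
- exact: finset.set1_inj.
- by move=> /(congr1 (fun B : {set T} => #|B|)); rewrite cards1 cardsC1; lia.
- by move=> /(congr1 (fun B : {set T} => #|B|)); rewrite cards1 cardsC1; lia.
- by move=> /finset.setC_inj /finset.set1_inj.
Qed.

(** With [t] the mass of [A], [2 t (1 - t) = 1/2 - 2 (t - 1/2)^2]; trivial cuts have [t] equal to 0
    or 1 and drop out. *)
Lemma energy_cutdist lam w : \sum_x w x = 1 ->
  \sum_x \sum_y w x * w y * cutdist lam x y =
  \sum_(A | splits [set: T]%SET A)
    lam A * (2^-1 - 2 * (\sum_(x in A) w x - 2^-1) ^+ 2).
Proof.
move=> w1; rewrite sum_cutdist [RHS]big_mkcond/=; apply: eq_bigr => A _.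
have : \sum_(x in A) w x + \sum_(x | x \notin A) w x = 1.
  by rewrite -w1 [RHS](bigID (mem A)).
rewrite addrC => /(canRL (addrK _)) wA.
rewrite wA; case: ifPn => [_|]; first by field.
rewrite /splits finset.setTI finset.setTD negb_and -!eqn0Ngt.
move=> /orP[/eqP/card0_eq A0|/eqP/card0_eq A0].
  by rewrite (big_pred0 _ _ _ _ A0) mulr0 mul0r mulr0.
have : \sum_(x | x \notin A) w x = 0.
  by apply: big_pred0 => x; have := A0 x; rewrite inE.
by rewrite wA => ->; rewrite !mulr0.
Qed.

Lemma energy_cutdist_le lam w (D : R) : (forall A, 0 <= lam A) ->
  (forall x y, cutdist lam x y <= D) -> \sum_x w x = 1 ->
  \sum_x \sum_y w x * w y * cutdist lam x y <= #|T|%:R / 4 * D.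
Proof.
move=> lam0 lamD w1; rewrite energy_cutdist//.
have := sum_splits_le [set: T]%SET lam0 lamD; rewrite cardsT => h.
apply: (@le_trans _ _ ((\sum_(A | splits [set: T]%SET A) lam A) / 2)); last by lra.
rewrite mulr_suml; apply: ler_sum => A _; rewrite ler_wpM2l//.
by rewrite gerBl mulr_ge0// sqr_ge0.
Qed.

(** By convexity the sum is least for constant [w], with value [(k - 2)^2 / (4 k)]. This is at least
    1/4 when [(k - 1) (k - 4) >= 0], which is where four points are used. *)
Lemma sum_sqr_centered_ge w : (3 < #|T|)%N -> \sum_x w x = 1 ->
  4^-1 <= \sum_x (w x - 2^-1) ^+ 2.
Proof.
move=> T4 w1; set k : R := #|T|%:R.
have k4 : 4 <= k by rewrite /k ler_nat.
(* Compare with the tangent of the square at the mean value [c]. *)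
pose c : R := k^-1 - 2^-1.
apply: (@le_trans _ _ (\sum_x (2 * c * (w x - 2^-1) - c ^+ 2))); last first.
  apply: ler_sum => x _; rewrite -subr_ge0.
  by rewrite (_ : _ - _ = (w x - 2^-1 - c) ^+ 2) ?sqr_ge0//; ring.
rewrite big_split/= -mulr_sumr big_split/= w1 !sumr_const.
rewrite -[_ *+ #|T|]mulr_natr -[(- c ^+ 2) *+ #|T|]mulr_natr -/k.
have k0 : k != 0 by rewrite gt_eqF//; lra.
rewrite (_ : 2 * c * _ + _ = k * (2^-1 - k^-1) ^+ 2); last by rewrite /c; field.
rewrite (_ : k * _ = (k - 2) ^+ 2 / (4 * k)); last by field.
rewrite ler_pdivlMr; last by lra.
nra.
Qed.

Lemma energy_cutdist_le_sharp lam w (D : R) : (3 < #|T|)%N ->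
  (forall A, 0 <= lam A) ->
  (forall x y, cutdist lam x y <= D) -> \sum_x w x = 1 ->
  \sum_x \sum_y w x * w y * cutdist lam x y <= (#|T|%:R - 1) / 4 * D.
Proof.
move=> T4 lam0 lamD w1; rewrite energy_cutdist//.
pose L p := \sum_(A | isolates p A) lam A.
pose v A := (\sum_(x in A) w x - 2^-1) ^+ 2.
have v0 A : 0 <= v A by exact: sqr_ge0.
have /card_gt0P[x0 _] : (0 < #|T|)%N by lia.
have [p _ pmin] := @arg_minP _ _ _ x0 predT L isT.
have Lp0 : 0 <= L p by apply: sumr_ge0.
set M := \sum_(A | splits [set: T]%SET A) lam A.
have MD : M - L p <= (#|T|%:R - 1) / 2 * D.
  have := sum_splits_le (~: [set p]%SET) lam0 lamD.
  rewrite cardsC1 -subn1 natrB; last by lia.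
  apply: le_trans; rewrite lerBlDr /M.
  rewrite (bigID (isolates p))/= addrC lerD//.
    rewrite big_mkcond/= [leRHS]big_mkcond/=; apply: ler_sum => A _.
    case: ifPn => [/andP[sA iA]|_]; first by rewrite splits_isolates.
    by case: ifP.
  rewrite big_mkcond/= [leRHS]big_mkcond/=; apply: ler_sum => A _.
  by case: (splits _ _) => //=; case: ifP.
(* Both sides of a cut isolating [q] have mass at the same distance from 1/2, and no cut isolates
   two points, so no weight is counted twice. *)
have Lv : \sum_q L q * (w q - 2^-1) ^+ 2 <=
    \sum_(A | splits [set: T]%SET A) lam A * v A.
  have vE q A : isolates q A -> v A = (w q - 2^-1) ^+ 2.
    rewrite /v => /orP[]/eqP->; first by rewrite big_set1.
    have : w q + \sum_(x in ~: [set q]%SET) w x = 1.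
      rewrite -w1 [RHS](bigD1 q)//=; congr (_ + _).
      by apply: eq_bigl => x; rewrite !inE.
    by move=> /(canRL (addKr _)) ->; field.
  under eq_bigr do rewrite mulr_suml.
  rewrite (exchange_big_dep (splits [set: T]%SET))/=; last first.
    by move=> q A _; apply: isolates_splits; lia.
  apply: ler_sum => A _.
  under eq_bigr => q qA do rewrite -(vE q A)//.
  rewrite sumr_const -[leLHS]mulr_natr.
  apply: ler_piMr; first exact: mulr_ge0.
  rewrite lern1.
  by apply/card_le1_eqP => q r qA rA; apply: (@isolates_inj r q A) => //; lia.
have Lw : L p / 4 <= \sum_q L q * (w q - 2^-1) ^+ 2.
  apply: (@le_trans _ _ (L p * \sum_q (w q - 2^-1) ^+ 2)).
    by rewrite ler_wpM2l// sum_sqr_centered_ge.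
  rewrite mulr_sumr; apply: ler_sum => q _.
  by rewrite ler_wpM2r ?sqr_ge0// pmin.
have -> : \sum_(A | splits [set: T]%SET A) lam A * (2^-1 - 2 * v A) =
    M / 2 - 2 * \sum_(A | splits [set: T]%SET A) lam A * v A.
  rewrite /M mulr_suml mulr_sumr -sumrB; apply: eq_bigr => A _; ring.
(* The energy is at most [M / 2 - 2 (L p / 4) = (M - L p) / 2], and [MD] bounds this. *)
lra.
Qed.

End cut_metrics.

Local Open Scope classical_set_scope.
Local Open Scope ring_scope.

(** * Integration against charges on a finite discrete space *)

Section finite_integration.
Context (d : measure_display) (T : measurableType d) (R : realType).
Variables (I : finType) (e : I -> T).
Hypotheses (e_inj : injective e) (e_surj : forall x, exists i, e i = x).
Hypothesis measurableI : forall i, measurable [set e i].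

Lemma measurable_discrete (A : set T) : measurable A.
Proof.
have -> : A = \bigcup_(i in [set i | A (e i)]) [set e i].
  apply/seteqP; split=> [x Ax|x [i /= Ai ->]//].
  by have [i xE] := e_surj x; exists i => //=; rewrite xE.
by apply: fin_bigcup_measurable => //; exact: finite_finset.
Qed.

Lemma integral_discrete (mu : {finite_measure set T -> \bar R}) (f : T -> R) :
  (\int[mu]_x (f x)%:E)%E = (\sum_i f (e i) * fine (mu [set e i]))%:E.
Proof.
have setTE : [set: T] = \big[setU/set0]_(i <- index_enum I) [set e i].
  apply/seteqP; split=> // x _; have [i <-] := e_surj x.
  by rewrite -bigcup_seq; exists i => //=; rewrite mem_index_enum.
rewrite {1}setTE integral_bigsetU_EFin//=.
- rewrite -sumEFin; apply: eq_bigr => i _.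
  rewrite EFinM fineK ?fin_num_measure// -integral_cst//.
  by apply: eq_integral => x; rewrite inE => ->.
- exact: index_enum_uniq.
- by move=> i j _ _ [x [-> /e_inj]].
- by move=> _ Y mY; exact: measurable_discrete.
Qed.

(** Both Jordan parts are finite measures, so their integrals are finite sums, and on each singleton
    the parts differ by [nu]. *)
Lemma charge_integral_discrete (nu : {charge set T -> \bar R}) (f : T -> R) :
  charge_integral nu (fun x => (f x)%:E) =
  (\sum_i f (e i) * fine (nu [set e i]))%:E.
Proof.
rewrite /charge_integral !integral_discrete -EFinB -sumrB; congr EFin.
apply: eq_bigr => i _; rewrite -mulrBr; congr (_ * _).
rewrite (jordan_decomp (hahn_pos_neg nu) (measurableI i))/=.
by rewrite /cadd/= cscaleN1 fineB// fin_num_measure.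
Qed.

Lemma charge_setT_discrete (nu : {charge set T -> \bar R}) :
  nu [set: T] = (\sum_i fine (nu [set e i]))%:E.
Proof.
transitivity (charge_integral nu (fun=> 1%:E)).
  rewrite /charge_integral !integral_cst// !mul1e.
  by rewrite (jordan_decomp (hahn_pos_neg nu) measurableT)/= /cadd/= cscaleN1.
by rewrite charge_integral_discrete; under eq_bigr do rewrite mul1r.
Qed.

End finite_integration.

(** * Energy on a finite metric space, and the 1-norm as a cut metric *)

Lemma borel_measurable_set1 (R : realType) (T : pointedMetricType R) (x : T) :
  measurable ([set x] : set (borelType T)).
Proof.
rewrite -[X in measurable X]setCK; apply: measurableC.
apply: sub_sigma_algebra; rewrite /= openC.
by apply: (@accessible_closed_set1 T); exact/hausdorff_accessible/metric_hausdorff.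
Qed.

Lemma energy_discrete (R : realType) (T : pointedMetricType R) (I : finType)
    (e : I -> borelType T) (mu : {charge set (borelType T) -> \bar R}) :
  injective e -> (forall x, exists i, e i = x) ->
  let w i := fine (mu [set e i]) in
  energy mu = (\sum_i \sum_j w i * w j * mdist (e i : T) (e j : T))%:E.
Proof.
move=> e_inj e_surj w; rewrite /energy.
have me i : measurable ([set e i] : set (borelType T)).
  exact: borel_measurable_set1.
under [X in charge_integral _ X]eq_fun do
  rewrite (charge_integral_discrete e_inj e_surj me).
rewrite (charge_integral_discrete e_inj e_surj me).
congr EFin; apply: eq_bigr => i _; rewrite mulr_suml; apply: eq_bigr => j _.
by rewrite -/(w i) -/(w j) mulrC mulrAC -mulrA.
Qed.

(** Each coordinate gives a cut metric on the line, and the 1-norm adds these up, hence also their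
    weights. *)
Lemma l1dist_cutdist (R : realType) (n : nat) (T : finType)
    (u : T -> l1space R n) : exists lam : {set T} -> R,
  (forall A, 0 <= lam A) /\ forall x y, mdist (u x) (u y) = cutdist lam x y.
Proof.
pose coord i x := (u x : 'rV[R]_n) 0 i.
have [lam lamP] := choice (fun i => line_cutdist (coord i)).
exists (fun A => \sum_i lam i A); split=> [A|x y].
  by apply: sumr_ge0 => i _; have [] := lamP i.
rewrite cutdist_sum; apply: eq_bigr => i _.
by have [_ <-] := lamP i; rewrite /coord !mxE.
Qed.

Lemma card_eq_I_enum (T : Type) (X : set T) (k : nat) :
  (X #= `I_k)%card -> exists e : 'I_k -> X,
  injective e /\ forall x, exists i, e i = x.
Proof.
move=> /card_set_bijP[f [fX finj fsurj]].
have /choice[e eP] (i : 'I_k) : exists x : X, f (val x) = i.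
  have [x Xx fx] := fsurj i (ltn_ord i).
  by exists (exist _ x (mem_set Xx)).
exists e; split=> [i j eij|x]; first by apply: val_inj; rewrite /= -!eP eij.
have Xx : X (val x) := set_mem (valP x).
exists (Ordinal (fX _ Xx : (f (val x) < k)%N)).
apply: val_inj; apply: finj; rewrite ?inE ?eP//.
exact: set_mem (valP _).
Qed.

Theorem theorem4p8 (R : realType) (n k : nat) (X : set (l1space R n))
    (X0 : X !=set0) :
  (2 <= n)%N -> (X #= `I_k)%card -> (k <= 2 * n)%N ->
  (M_const (subspaceType X0) <=
   (Num.min (k%:R / 4) (n%:R / 2 - 1 / 4))%:E * diameter (subspaceType X0))%E.
Proof.
move=> n2 Xk kn; set T := subspaceType X0.
have [e [e_inj e_surj]] := card_eq_I_enum Xk.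
have [x0 Xx0] := X0.
have [i0 _] := e_surj (exist _ x0 (mem_set Xx0)).
have k0 : (0 < k)%N by apply: leq_ltn_trans (ltn_ord i0).
pose c : R := Num.min (k%:R / 4) (n%:R / 2 - 1 / 4).
have nR : 2 <= n%:R :> R by rewrite ler_nat.
have c0 : 0 < c.
  by rewrite lt_min divr_gt0 ?ltr0n//=; lra.
have dD x y : ((mdist (x : T) y)%:E <= diameter T)%E.
  by apply: ereal_sup_ubound; exists (x, y).
apply: ge_ereal_sup => _ [mu /= mu1 <-].
have D0 : (0 <= diameter T)%E by rewrite (le_trans _ (dD (e i0) (e i0)))// mdistxx.
(* [D0] excludes the value [-oo]; for [+oo] the right-hand side is infinite because [c] is
   positive. *)
rewrite -/c; move: dD D0; case: (diameter T) => [D| |] dD D0 //; last first.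
  by rewrite gt0_muley ?lte_fin// leey.
have me i : measurable ([set e i] : set (borelType T)).
  exact: borel_measurable_set1.
have := @charge_setT_discrete _ (borelType T) R _ e e_inj e_surj me mu.
rewrite mu1 => -[/esym w1].
rewrite (@energy_discrete _ T _ e mu e_inj e_surj) -EFinM lee_fin.
have [lam [lam0 lamP]] := l1dist_cutdist (fun i => set_val (e i)).
have lamE i j : mdist (e i : T) (e j : T) = cutdist lam i j by exact: lamP.
under eq_bigr do under eq_bigr do rewrite lamE.
have lamD i j : cutdist lam i j <= D by rewrite -lamE -lee_fin dD.
have D0' : 0 <= D by rewrite -lee_fin.
have [k4|k4] := ltnP 3 k.
  apply: le_trans (energy_cutdist_le_sharp _ lam0 lamD w1) _; rewrite ?card_ord//.
  rewrite ler_wpM2r// le_min.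
  have : k%:R <= 2 * n%:R :> R by rewrite -natrM ler_nat.
  by move=> kn'; apply/andP; split; lra.
apply: le_trans (energy_cutdist_le lam0 lamD w1) _; rewrite ?card_ord//.
rewrite ler_wpM2r// le_min lexx/=.
have : k%:R <= 3 :> R by rewrite ler_nat.
by lra.
Qed.
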